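(* Let $A$ be a nonnegative $d_1$-dimensional matrix of order $n$ and let $B$ be a nonnegative $d_2$-dimensional matrix of order $n$, where $d_1+d_2\ge 3$. Then $$\operatorname{per}(AB)\ge\operatorname{per}A\cdot\operatorname{per}B,$$ where $AB$ denotes the dot product.
   Context: Let $I_n^d = \{1,\ldots,n\}^d$ with $n,d$ positive integers. A $d$-dimensional matrix $A$ of order $n$ is an array $(a_\alpha)_{\alpha\in I_n^d}$ of real numbers; it is nonnegative if all $a_\alpha\ge0$. A diagonal in a $d$-dimensional matrix of order $n$ is a set of indices $\{\alpha^1,\ldots,\alpha^n\}\subset I_n^d$ such that $\alpha^i_k\ne\alpha^j_k$ for all $k\in\{1,\ldots,d\}$ and all $i\neq j$. With $\mathcal{D}(A)$ the set of all diagonals, the permanent of $A$ is $\operatorname{per}A=\sum_{D\in\mathcal{D}(A)}\prod_{\alpha\in D}a_\alpha$. The dot product $AB$ of a $d_1$-dimensional matrix $A$ and a $d_2$-dimensional matrix $B$, both of order $n$, is the $(d_1+d_2-2)$-dimensional matrix $C$ of order $n$ with entries $c_{\alpha\beta}=\sum_{i=1}^n a_{\alpha i}\,b_{i\beta}$ for $\alpha\in I_n^{d_1-1}$, $\beta\in I_n^{d_2-1}$, where juxtaposition denotes concatenation of indices. *)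

(* Defs.v *)
From HB Require Import structures.
From mathcomp Require Import all_boot all_order all_algebra.
From mathcomp Require Import reals.

Set Implicit Arguments.
Unset Strict Implicit.
Unset Printing Implicit Defensive.

Import Order.TTheory GRing.Theory Num.Theory.
Local Open Scope ring_scope.

(* The index set I_n^d is d.-tuple 'I_n, with 'I_n in place of {1, ..., n}.  *)
Notation mdmatrix R d n := {ffun d.-tuple 'I_n -> R}.

Definition nonneg_mdmx (R : numDomainType) (d n : nat) (A : mdmatrix R d n) :
  Prop := forall alpha : d.-tuple 'I_n, 0 <= A alpha.

(* For d > 0 the second conjunct already makes the listed indices            *)
(* alpha^1, ..., alpha^n pairwise distinct, hence the cardinality n.         *)
Definition is_diagonal (d n : nat) (D : {set d.-tuple 'I_n}) : bool :=
  (#|D| == n) &&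
  [forall alpha in D, forall beta in D, (alpha != beta) ==>
     [forall k : 'I_d, tnth alpha k != tnth beta k]].

Definition per (R : comNzRingType) (d n : nat) (A : mdmatrix R d n) : R :=
  \sum_(D : {set d.-tuple 'I_n} | is_diagonal D) \prod_(alpha in D) A alpha.

Definition index_left (p q n : nat) (gamma : (p + q).-tuple 'I_n) :
  p.-tuple 'I_n := [tuple tnth gamma (lshift q k) | k < p].

Definition index_right (p q n : nat) (gamma : (p + q).-tuple 'I_n) :
  q.-tuple 'I_n := [tuple tnth gamma (rshift p k) | k < q].

(* Positive dimensions are written d1 = p.+1 and d2 = q.+1, so that          *)
(* d1 + d2 - 2 = p + q; see dot_mdmxE for the entries at a concatenation.    *)
Definition dot_mdmx (R : comNzRingType) (p q n : nat)
    (A : mdmatrix R p.+1 n) (B : mdmatrix R q.+1 n) : mdmatrix R (p + q) n :=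
  [ffun gamma : (p + q).-tuple 'I_n => \sum_(i < n)
     A [tuple of rcons (index_left gamma) i] *
     B [tuple of i :: index_right gamma]].

Lemma index_left_cat (p q n : nat) (alpha : p.-tuple 'I_n)
    (beta : q.-tuple 'I_n) : index_left [tuple of alpha ++ beta] = alpha.
Proof. by apply: eq_from_tnth => k; rewrite tnth_mktuple tnth_lshift. Qed.

Lemma index_right_cat (p q n : nat) (alpha : p.-tuple 'I_n)
    (beta : q.-tuple 'I_n) : index_right [tuple of alpha ++ beta] = beta.
Proof. by apply: eq_from_tnth => k; rewrite tnth_mktuple tnth_rshift. Qed.

Lemma dot_mdmxE (R : comNzRingType) (p q n : nat) (A : mdmatrix R p.+1 n)
    (B : mdmatrix R q.+1 n) (alpha : p.-tuple 'I_n) (beta : q.-tuple 'I_n) :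
  dot_mdmx A B [tuple of alpha ++ beta] =
  \sum_(i < n) A [tuple of rcons alpha i] * B [tuple of i :: beta].
Proof. by rewrite ffunE index_left_cat index_right_cat. Qed.

(* Main.v *)
Require Import Defs.
From mathcomp Require Import all_boot all_order all_algebra.
From mathcomp Require Import reals.

Set Implicit Arguments.
Unset Strict Implicit.
Unset Printing Implicit Defensive.

Import Order.TTheory GRing.Theory Num.Theory.
Local Open Scope ring_scope.

(** A diagonal of a matrix of dimension d > 0 takes each value exactly once in
    every coordinate.  Listing its indices by the value of one chosen coordinate
    turns a permanent into a sum over latin arrays, i.e. families of n indices
    whose coordinates are all injective ([per_latinE]).

    List the diagonals of A by their last coordinate and those of B by their
    first one, the two coordinates contracted in AB.  A pair of diagonals
    is then the same thing as one latin array H of indices of dimension p + q: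
    the i-th index of H juxtaposes what is left of the i-th indices of the two
    diagonals.  Hence ([per_mul_latinE])
      per A * per B = sum over H of prod_i a_(left (H i), i) b_(i, right (H i)).

    On the other side, per (AB) is a sum over diagonals D of
    prod_(gamma in D) sum_i a_(left gamma, i) b_(i, right gamma).  Expanding
    the product gives one term for every map D -> I_n; the bijective maps are
    the inverses of the latin arrays enumerating D, with the same terms, and
    the other terms are nonnegative ([sum_enumerations_le_prod_sum]).
    Summing over D gives the inequality.  The hypothesis d1 + d2 >= 3 says that
    p + q > 0, so that a latin array is injective and its image is a
    diagonal. *)

(** * Expanding a product of sums along enumerations *)

(** Expanding the right-hand side gives a term for every function f from D to
    I.  An enumeration H of D contributes the term of its inverse function, and
    distinct enumerations have distinct inverses; the remaining terms are
    nonnegative. *)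
Lemma sum_enumerations_le_prod_sum (R : numDomainType) (I T : finType) (i0 : I)
    (g : I -> T -> R) (D : {set T}) :
  (forall i x, 0 <= g i x) ->
  \sum_(H : {ffun I -> T} | injectiveb H && (H @: I == D)) \prod_i g i (H i)
    <= \prod_(x in D) \sum_i g i x.
Proof.
move=> g_ge0; rewrite (big_distr_big_dep i0) /=.
(* Outside D, pfamily requires the default value i0. *)
pose inv (H : {ffun I -> T}) : {ffun T -> I} :=
  [ffun x => if x \in D then odflt i0 [pick i | H i == x] else i0].
pose E := [set H : {ffun I -> T} | injectiveb H && (H @: I == D)].
have ED H : H \in E -> injective H /\ forall x, (x \in H @: I) = (x \in D).
  by rewrite inE => /andP[/injectiveP Hinj /eqP <-].
have invK H i : H \in E -> inv H (H i) = i.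
  move=> /ED[Hinj HD]; rewrite ffunE -HD imset_f //.
  by case: pickP => [j /eqP/Hinj | /(_ i)] //=; rewrite eqxx.
have inv_inj : {in E &, injective inv}.
  move=> H H' HE HE' eqHH'; apply/ffunP => i.
  have /imsetP[j _ Hij] : H i \in H' @: I.
    by have [_ ->] := ED _ HE'; have [_ <-] := ED _ HE; rewrite imset_f.
  by rewrite Hij; congr (H' _); rewrite -[LHS](invK H') // -Hij -eqHH' invK.
have -> : \sum_(H : {ffun I -> T} | injectiveb H && (H @: I == D))
      \prod_i g i (H i)
    = \sum_(f in inv @: E) \prod_(x in D) g (f x) x.
  rewrite big_imset //=; apply: eq_big => [H|H HE]; first by rewrite inE.
  have {}HE : H \in E by rewrite inE.
  have [Hinj _] := ED _ HE.
  have <- : H @: I = D by move: HE; rewrite inE => /andP[_ /eqP].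
  rewrite big_imset /=; last by move=> ? ? _ _ /Hinj.
  by apply: eq_bigr => i _; rewrite invK.
rewrite [leRHS](bigID (mem (inv @: E))) /=.
rewrite -[leLHS]addr0 lerD //; last first.
  by apply: sumr_ge0 => f _; apply: prodr_ge0.
rewrite le_eqVlt; apply/orP; left; apply/eqP; apply: eq_bigl => f.
rewrite andbC; case: imsetP => //= -[H _ ->].
apply/esym/pfamilyP; split=> //.
by apply/supportP => x /negbTE xD; rewrite ffunE xD.
Qed.

(** * Diagonals as latin arrays *)

Definition latin (d n : nat) (H : {ffun 'I_n -> d.-tuple 'I_n}) : bool :=
  [forall k : 'I_d, injectiveb (fun i => tnth (H i) k)].

Lemma latinP (d n : nat) (H : {ffun 'I_n -> d.-tuple 'I_n}) :
  reflect (forall k, injective (fun i => tnth (H i) k)) (latin H).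
Proof. by apply: (iffP forallP) => Hk k; apply/injectiveP. Qed.

Lemma latin_inj (d n : nat) (H : {ffun 'I_n -> d.-tuple 'I_n}) :
  (0 < d)%N -> latin H -> injective H.
Proof.
move=> d_gt0 /latinP/(_ (Ordinal d_gt0)) Hinj i j eqH.
by apply: Hinj; rewrite eqH.
Qed.

Lemma latin_diagonal (d n : nat) (H : {ffun 'I_n -> d.-tuple 'I_n}) :
  (0 < d)%N -> latin H -> is_diagonal (H @: 'I_n).
Proof.
move=> d_gt0 Hlat; apply/andP; split.
  by rewrite card_imset ?card_ord //; apply: latin_inj.
apply/forall_inP => _ /imsetP[i _ ->]; apply/forall_inP => _ /imsetP[j _ ->].
apply/implyP => neqH; apply/forallP => k; apply: contraNneq neqH => eqk.
by move/latinP: Hlat => /(_ k i j eqk) ->.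
Qed.

Lemma diagonal_tnth_inj (d n : nat) (D : {set d.-tuple 'I_n}) (k : 'I_d) :
  is_diagonal D -> {in D &, injective (fun alpha => tnth alpha k)}.
Proof.
move=> /andP[_ /forall_inP diagD] alpha beta aD bD eqk; apply/eqP.
move/forall_inP/(_ beta bD)/implyP: (diagD alpha aD); case: eqVneq => // _.
by move/(_ isT)/forallP/(_ k); rewrite eqk eqxx.
Qed.

(** The n indices of a diagonal have n distinct values in coordinate k, so by
    counting every value occurs. *)
Lemma diagonal_tnth_onto (d n : nat) (D : {set d.-tuple 'I_n}) (k : 'I_d)
    (i : 'I_n) :
  is_diagonal D -> exists2 alpha, alpha \in D & tnth alpha k = i.
Proof.
move=> diagD; have /andP[/eqP cardD _] := diagD.
have /eqP tD : [set tnth alpha k | alpha in D] == [set: 'I_n].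
  rewrite eqEcard subsetT cardsT card_ord card_in_imset ?cardD ?leqnn //.
  exact: (diagonal_tnth_inj diagD).
have : i \in [set tnth alpha k | alpha in D] by rewrite tD inE.
by case/imsetP => alpha aD ->; exists alpha.
Qed.

(** A diagonal has n! enumerations; prescribing coordinate k of every entry
    selects one of them, because this coordinate is a bijection from the
    diagonal onto I_n. *)
Lemma per_latinE (R : comNzRingType) (d n : nat) (k : 'I_d)
    (A : mdmatrix R d n) :
  per A = \sum_(H : {ffun 'I_n -> d.-tuple 'I_n} |
                latin H && [forall i, tnth (H i) k == i]) \prod_i A (H i).
Proof.
have d_gt0 : (0 < d)%N by apply: leq_trans (ltn_ord k).
pose enumD (D : {set d.-tuple 'I_n}) : {ffun 'I_n -> d.-tuple 'I_n} :=
  [ffun i => odflt [tuple i | _ < d]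
     [pick alpha in D | tnth alpha k == i]].
have enumDP D i : is_diagonal D -> enumD D i \in D /\ tnth (enumD D i) k = i.
  move=> diagD; rewrite ffunE; case: pickP => [alpha /andP[aD /eqP]|] //=.
  have [alpha aD ak] := diagonal_tnth_onto k i diagD.
  by move/(_ alpha); rewrite aD ak eqxx.
have enumDK D : is_diagonal D -> enumD D @: 'I_n = D.
  move=> diagD; apply/setP => alpha; apply/imsetP/idP => [[i _ ->]|aD].
    by have [] := enumDP D i diagD.
  exists (tnth alpha k) => //.
  have [eD ek] := enumDP D (tnth alpha k) diagD.
  by apply: (diagonal_tnth_inj (k := k) diagD) => //=; rewrite ek.
rewrite /per (reindex_onto (fun H : {ffun 'I_n -> d.-tuple 'I_n} => H @: 'I_n)
  enumD) /=; last exact: enumDK.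
apply: eq_big => [H|H /andP[diagH /eqP eH]].
  apply/andP/andP => [[diagH /eqP eH]|[Hlat /forallP Hk]]; split.
  - have Hk i : tnth (H i) k = i by rewrite -{1}eH; have [] := enumDP _ i diagH.
    apply/latinP => l i j eql; rewrite -(Hk i) -(Hk j); congr (tnth _ k).
    by apply: (diagonal_tnth_inj (k := l) diagH) => //; rewrite imset_f.
  - by apply/forallP => i; rewrite -{1}eH; have [_ ->] := enumDP _ i diagH.
  - exact: latin_diagonal.
  have diagH := latin_diagonal d_gt0 Hlat.
  apply/eqP/ffunP => i; have [/imsetP[j _ eij] ek] := enumDP _ i diagH.
  by rewrite eij; congr (H _); rewrite -ek eij; apply/eqP; rewrite eq_sym.
rewrite big_imset //= => i j _ _ eqij.
have [_ <-] := enumDP _ i diagH; have [_ <-] := enumDP _ j diagH.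
by rewrite eH eqij.
Qed.

(** * The product of two permanents *)

Lemma tnth_rcons_widen (T : Type) (p : nat) (t : p.-tuple T) (x : T)
    (k : 'I_p) :
  tnth [tuple of rcons t x] (widen_ord (leqnSn p) k) = tnth t k.
Proof.
by rewrite !(tnth_nth x) /= nth_rcons size_tuple ltn_ord.
Qed.

Lemma tnth_rcons_max (T : Type) (p : nat) (t : p.-tuple T) (x : T) :
  tnth [tuple of rcons t x] ord_max = x.
Proof. by rewrite (tnth_nth x) /= nth_rcons size_tuple ltnn eqxx. Qed.

Lemma ord_widen_or_max (p : nat) (k : 'I_p.+1) :
  {j : 'I_p | k = widen_ord (leqnSn p) j} + {k = ord_max}.
Proof.
have [lt_kp|le_pk] := ltnP k p.
  by left; exists (Ordinal lt_kp); apply/val_inj.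
by right; apply/val_inj/eqP; rewrite eqn_leq /= le_pk -ltnS ltn_ord.
Qed.

(** Enumerate the diagonals of A and of B by the contracted coordinate.  In both
    arrays this coordinate of the i-th index is i, so it carries no information,
    and the constraints on the other coordinates bear on each of them
    separately: deleting it from a pair of arrays and juxtaposing what remains
    is a bijection onto the latin arrays of dimension p + q. *)
Lemma per_mul_latinE (R : comNzRingType) (n p q : nat)
    (A : mdmatrix R p.+1 n) (B : mdmatrix R q.+1 n) :
  per A * per B =
  \sum_(H : {ffun 'I_n -> (p + q).-tuple 'I_n} | latin H)
    \prod_i (A [tuple of rcons (index_left (H i)) i] *
             B [tuple of i :: index_right (H i)]).
Proof.
rewrite (per_latinE ord_max A) (per_latinE ord0 B).
rewrite big_distrlr /= pair_big /=.
pose split (H : {ffun 'I_n -> (p + q).-tuple 'I_n}) :=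
  ([ffun i => [tuple of rcons (index_left (H i)) i]],
   [ffun i => [tuple of i :: index_right (H i)]])
  : {ffun 'I_n -> p.+1.-tuple 'I_n} * {ffun 'I_n -> q.+1.-tuple 'I_n}.
pose join (HH : {ffun 'I_n -> p.+1.-tuple 'I_n} *
                {ffun 'I_n -> q.+1.-tuple 'I_n}) :
    {ffun 'I_n -> (p + q).-tuple 'I_n} :=
  [ffun i => [tuple of
     [tuple tnth (HH.1 i) (widen_ord (leqnSn p) k) | k < p] ++
     [tuple tnth (HH.2 i) (lift ord0 k) | k < q]]].
rewrite (reindex_onto split join) /=; last first.
  move=> [H1 H2] /= /andP[/andP[_ /forallP Hmax] /andP[_ /forallP H0]].
  congr (_, _); apply/ffunP => i;
    rewrite !ffunE ?index_left_cat ?index_right_cat.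
    apply: eq_from_tnth => k; have [[j ->]|->] := ord_widen_or_max k.
      by rewrite tnth_rcons_widen tnth_mktuple.
    by rewrite tnth_rcons_max; apply/esym/eqP.
  apply: eq_from_tnth => k; case: (unliftP ord0 k) => [j|] ->.
    by rewrite tnthS tnth_mktuple.
  by rewrite tnth0; apply/esym/eqP.
have splitK H : join (split H) = H.
  apply/ffunP => i; rewrite !ffunE; apply: eq_from_tnth => k.
  case: (split_ordP k) => j ->.
    by rewrite tnth_lshift tnth_mktuple ?ffunE tnth_rcons_widen tnth_mktuple.
  by rewrite tnth_rshift tnth_mktuple ?ffunE tnthS tnth_mktuple.
apply: eq_big => [H|H _]; last first.
  by rewrite -big_split; apply: eq_bigr => i _; rewrite !ffunE.
rewrite splitK eqxx andbT.
have -> : [forall i, tnth ((split H).1 i) ord_max == i].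
  by apply/forallP => i; rewrite ffunE tnth_rcons_max.
have -> : [forall i, tnth ((split H).2 i) ord0 == i].
  by apply/forallP => i; rewrite ffunE tnth0.
rewrite !andbT; apply/andP/latinP => [[/latinP H1 /latinP H2] k i j|Hlat].
  case: (split_ordP k) => l -> eql.
    apply: (H1 (widen_ord (leqnSn p) l)).
    by rewrite !ffunE !tnth_rcons_widen !tnth_mktuple.
  by apply: (H2 (lift ord0 l)); rewrite !ffunE !tnthS !tnth_mktuple.
split; apply/latinP => k i j.
  rewrite !ffunE; have [[l ->]|->] := ord_widen_or_max k.
    by rewrite !tnth_rcons_widen !tnth_mktuple => /Hlat.
  by rewrite !tnth_rcons_max.
rewrite !ffunE; case: (unliftP ord0 k) => [l|] ->; last by rewrite !tnth0.
by rewrite !tnthS !tnth_mktuple => /Hlat.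
Qed.

(** * The inequality *)

Theorem theorem11 (R : realType) (n p q : nat)
    (A : mdmatrix R p.+1 n) (B : mdmatrix R q.+1 n) :
  (0 < n)%N -> (3 <= p.+1 + q.+1)%N ->
  nonneg_mdmx A -> nonneg_mdmx B ->
  per A * per B <= per (dot_mdmx A B).
Proof.
move=> n_gt0 pq_ge3 A_ge0 B_ge0.
have pq_gt0 : (0 < p + q)%N by move: pq_ge3; rewrite addSn addnS.
rewrite per_mul_latinE.
rewrite (partition_big (fun H : {ffun 'I_n -> _} => H @: 'I_n)
  (@is_diagonal (p + q) n)) /=; last by move=> H; apply: latin_diagonal.
apply: ler_sum => D diagD.
under [leRHS]eq_bigr do rewrite ffunE.
pose g i (gamma : (p + q).-tuple 'I_n) :=
  A [tuple of rcons (index_left gamma) i] * B [tuple of i :: index_right gamma].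
have g_ge0 i gamma : 0 <= g i gamma by apply: mulr_ge0.
apply: le_trans (sum_enumerations_le_prod_sum (Ordinal n_gt0) D g_ge0).
rewrite le_eqVlt; apply/orP; left; apply/eqP; apply: eq_bigl => H.
apply/andP/andP => [[/(latin_inj pq_gt0)/injectiveP ->]|] //.
move=> [/injectiveP Hinj /eqP HD]; rewrite HD eqxx; split=> //.
apply/latinP => k i j eqk; apply: Hinj.
by apply: (diagonal_tnth_inj (k := k) diagD); rewrite // -HD imset_f.
Qed.
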